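(* Let $f:\mathbb{R}^n\to\mathbb{R}$ be convex and satisfy the standing assumption given in the context, let $\lambda>0$, and let $F(x)=f(x)+\lambda\|x\|_1$. For any starting point $x_0\in\mathbb{R}^n$, any admissible constants (in particular any tolerance $\epsilon>0$), and any choices of $\mathcal{I}_k$ and $\bar d_k$ permitted by the algorithm, Algorithm FaRSA (described in the context) terminates finitely, i.e., after finitely many iterations it returns a point $x_k$ with $\max\{\|\beta(x_k)\|,\|\phi(x_k)\|\}\le\epsilon$.
   Context: Notation. $\|\cdot\|$ is the $\ell_2$-norm and $\|\cdot\|_1$ the $\ell_1$-norm on $\mathbb{R}^n$. For an index set $\mathcal{I}\subseteq\{1,\dots,n\}$, $[v]_{\mathcal{I}}$ is the subvector of $v$ with indices in $\mathcal{I}$ and $[M]_{\mathcal{I}\mathcal{I}}$ the corresponding submatrix of a symmetric matrix $M$. $\mathrm{sgn}(v)$ is the componentwise sign ($0$, $1$ or $-1$ according to whether the component is zero, positive or negative). Problem. $\min_{x\in\mathbb{R}^n}F(x)$, $F(x):=f(x)+\lambda\|x\|_1$, $\lambda>0$. Standing assumption. $f:\mathbb{R}^n\to\mathbb{R}$ is convex, twice continuously differentiable, and bounded below on the level set $\mathcal{L}:=\{x\in\mathbb{R}^n:F(x)\le F(x_0)\}$; $\nabla f$ is Lipschitz continuous on $\mathcal{L}$ with constant $L>0$; and there are constants $\theta_{\min},\theta_{\max}>0$ with $\theta_{\min}\|v\|^2\le v^T\nabla^2f(x)v\le\theta_{\max}\|v\|^2$ for all $x\in\mathcal{L}$, $v\in\mathbb{R}^n$.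 Optimality measures. Let $\mathcal{I}^0(x)=\{i:[x]_i=0\}$, $\mathcal{I}^+(x)=\{i:[x]_i>0\}$, $\mathcal{I}^-(x)=\{i:[x]_i<0\}$. Define $[\beta(x)]_i=[\nabla f(x)]_i+\lambda$ if $i\in\mathcal{I}^0(x)$ and $[\nabla f(x)]_i+\lambda<0$; $[\beta(x)]_i=[\nabla f(x)]_i-\lambda$ if $i\in\mathcal{I}^0(x)$ and $[\nabla f(x)]_i-\lambda>0$; $[\beta(x)]_i=0$ otherwise. Define $[\phi(x)]_i=0$ if $i\in\mathcal{I}^0(x)$; $[\phi(x)]_i=\min\{[\nabla f(x)]_i+\lambda,\max\{[x]_i,[\nabla f(x)]_i-\lambda\}\}$ if $i\in\mathcal{I}^+(x)$ and $[\nabla f(x)]_i+\lambda>0$; $[\phi(x)]_i=\max\{[\nabla f(x)]_i-\lambda,\min\{[x]_i,[\nabla f(x)]_i+\lambda\}\}$ if $i\in\mathcal{I}^-(x)$ and $[\nabla f(x)]_i-\lambda<0$; $[\phi(x)]_i=[\nabla f(x)+\lambda\,\mathrm{sgn}(x)]_i$ otherwise. Projection. $[\mathrm{Proj}(y;x)]_i=\max\{0,[y]_i\}$ if $i\in\mathcal{I}^+(x)$, $\min\{0,[y]_i\}$ if $i\in\mathcal{I}^-(x)$, and $0$ if $i\in\mathcal{I}^0(x)$. Algorithm FaRSA. Input $x_0\in\mathbb{R}^n$; constants $\eta_\phi,\eta_\beta\in(0,1]$, $\xi\in(0,1)$, $\eta\in(0,1/2]$, $\gamma,\epsilon\in(0,\infty)$.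 For $k=0,1,2,\dots$: if $\max\{\|\beta(x_k)\|,\|\phi(x_k)\|\}\le\epsilon$, return $x_k$. Otherwise: ($\phi$-branch) If $\|\beta(x_k)\|\le\gamma\|\phi(x_k)\|$: choose any $\mathcal{I}_k\subseteq\{i:[\phi(x_k)]_i\ne0\}$ with $\|[\phi(x_k)]_{\mathcal{I}_k}\|\ge\eta_\phi\|\phi(x_k)\|$. Set $H_k=[\nabla^2F(x_k)]_{\mathcal{I}_k\mathcal{I}_k}=[\nabla^2f(x_k)]_{\mathcal{I}_k\mathcal{I}_k}$ and $g_k=[\nabla F(x_k)]_{\mathcal{I}_k}=[\nabla f(x_k)+\lambda\,\mathrm{sgn}(x_k)]_{\mathcal{I}_k}$ (all components of $x_k$ in $\mathcal{I}_k$ are nonzero). Let $d_k^R=-\alpha_kg_k$ with $\alpha_k=\|g_k\|^2/(g_k^TH_kg_k)$, and $m_k(d)=g_k^Td+\tfrac12d^TH_kd$. Compute any $\bar d_k$ with $g_k^T\bar d_k\le g_k^Td_k^R$ and $m_k(\bar d_k)\le m_k(0)$. Set $[d_k]_{\mathcal{I}_k}=\bar d_k$ and $[d_k]_i=0$ for $i\notin\mathcal{I}_k$. Obtain $x_{k+1}$ by Linesearch-$\phi$. ($\beta$-branch) Otherwise: choose any $\mathcal{I}_k\subseteq\{i:[\beta(x_k)]_i\ne0\}$ with $\|[\beta(x_k)]_{\mathcal{I}_k}\|\ge\eta_\beta\|\beta(x_k)\|$. Set $[d_k]_{\mathcal{I}_k}=-[\beta(x_k)]_{\mathcal{I}_k}$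 and $[d_k]_i=0$ for $i\notin\mathcal{I}_k$. Obtain $x_{k+1}$ by Linesearch-$\beta$. Linesearch-$\phi$. Set $j=0$, $y_0=\mathrm{Proj}(x_k+d_k;x_k)$. While $\mathrm{sgn}(y_j)\ne\mathrm{sgn}(x_k)$: if $F(y_j)\le F(x_k)$, return $x_{k+1}=y_j$; else replace $j$ by $j+1$ and set $y_j=\mathrm{Proj}(x_k+\xi^jd_k;x_k)$. After the while-loop, if $j\ne0$: let $\alpha_B=\sup\{\alpha>0:\mathrm{sgn}(x_k+\alpha d_k)=\mathrm{sgn}(x_k)\}$, and if $F(x_k+\alpha_Bd_k)\le F(x_k)+\eta\alpha_Bg_k^T\bar d_k$, return $x_{k+1}=x_k+\alpha_Bd_k$. Otherwise (or if $j=0$), starting from the current $j$, return $x_{k+1}=x_k+\xi^jd_k$ as soon as $F(x_k+\xi^jd_k)\le F(x_k)+\eta\xi^jg_k^T\bar d_k$, increasing $j$ by one after each failure. Linesearch-$\beta$. Return $x_{k+1}=x_k+\xi^jd_k$ for the smallest integer $j\ge0$ with $F(x_k+\xi^jd_k)\le F(x_k)-\eta\xi^j\|d_k\|^2$. *)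

(* Defs.v *)
From mathcomp Require Import all_boot all_order all_algebra.
From mathcomp Require Import all_classical all_reals all_analysis.

Set Implicit Arguments.
Unset Strict Implicit.
Unset Printing Implicit Defensive.

Import Order.TTheory GRing.Theory Num.Theory.
Import numFieldNormedType.Exports.

Local Open Scope classical_set_scope.
Local Open Scope ring_scope.

Section EuclideanSpace.
Context {R : realType}.

Definition dot n (u v : 'cV[R]_n) : R := (u^T *m v) 0 0.

(* The library norm on matrices is the sup norm, hence these two. *)
Definition norm2 n (v : 'cV[R]_n) : R := Num.sqrt (\sum_i v i 0 ^+ 2).

Definition norm1 n (v : 'cV[R]_n) : R := \sum_i `|v i 0|.

Definition sgn n (v : 'cV[R]_n) : 'cV[R]_n := map_mx Num.sg v.

Definition subvec n (I : {set 'I_n}) (v : 'cV[R]_n) : 'cV[R]_#|I| :=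
  rowsub (fun j : 'I_#|I| => enum_val j) v.

Definition submat n (I : {set 'I_n}) (M : 'M[R]_n) : 'M[R]_#|I| :=
  mxsub (fun j : 'I_#|I| => enum_val j) (fun j : 'I_#|I| => enum_val j) M.

Definition grad n (f : 'cV[R]_n -> R) (x : 'cV[R]_n) : 'cV[R]_n :=
  \col_i 'D_(delta_mx i 0) f x.

Definition hess n (f : 'cV[R]_n -> R) (x : 'cV[R]_n) : 'M[R]_n :=
  \matrix_(i, j) 'D_(delta_mx j 0) (fun y => grad f y i 0) x.

Definition twice_continuously_differentiable n (f : 'cV[R]_n -> R) : Prop :=
  [/\ forall x, differentiable f x,
      forall x, differentiable (grad f) x
    & continuous (hess f)].

End EuclideanSpace.

Section Problem.
Context {R : realType} {n : nat}.
Variables (f : 'cV[R]_n -> R) (lambda : R).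
Implicit Types (x y : 'cV[R]_n).

Definition objective x : R := f x + lambda * norm1 x.

Definition level_set x0 : set 'cV[R]_n :=
  [set x | objective x <= objective x0].

Record standing_assumption x0 : Prop := {
  sa_convex : convex_function [set: 'cV[R]_n] f;
  sa_C2 : twice_continuously_differentiable f;
  sa_bounded_below : exists m : R, forall x, level_set x0 x -> m <= f x;
  sa_lipschitz : exists2 L : R, 0 < L &
    forall x y, level_set x0 x -> level_set x0 y ->
      norm2 (grad f x - grad f y) <= L * norm2 (x - y);
  sa_hessian : exists theta_min theta_max : R,
    [/\ 0 < theta_min, 0 < theta_max &
      forall x v, level_set x0 x ->
        theta_min * norm2 v ^+ 2 <= dot v (hess f x *m v)
          <= theta_max * norm2 v ^+ 2]
}.

Definition beta x : 'cV[R]_n := \col_i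
  (let gp := grad f x i 0 + lambda in
   let gm := grad f x i 0 - lambda in
   if (x i 0 == 0) && (gp < 0) then gp
   else if (x i 0 == 0) && (0 < gm) then gm
   else 0).

Definition phi x : 'cV[R]_n := \col_i
  (let gp := grad f x i 0 + lambda in
   let gm := grad f x i 0 - lambda in
   if x i 0 == 0 then 0
   else if (0 < x i 0) && (0 < gp) then Num.min gp (Num.max (x i 0) gm)
   else if (x i 0 < 0) && (gm < 0) then Num.max gm (Num.min (x i 0) gp)
   else (grad f x + lambda *: sgn x) i 0).

Definition optimality x : R := Num.max (norm2 (beta x)) (norm2 (phi x)).

Definition proj y x : 'cV[R]_n := \col_i
  (if 0 < x i 0 then Num.max 0 (y i 0)
   else if x i 0 < 0 then Num.min 0 (y i 0)
   else 0).

(* [nabla F(x)]_I, meaningful when x has no zero component in I *)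
Definition reduced_grad (I : {set 'I_n}) x : 'cV[R]_#|I| :=
  subvec I (grad f x + lambda *: sgn x).

Definition reduced_hess (I : {set 'I_n}) x : 'M[R]_#|I| :=
  submat I (hess f x).

End Problem.

Record farsa_constants (R : realType) := FarsaConstants {
  eta_phi : R;
  eta_beta : R;
  xi : R;
  eta : R;
  gamma : R;
  eps : R;
  eta_phi_itv : 0 < eta_phi <= 1;
  eta_beta_itv : 0 < eta_beta <= 1;
  xi_itv : 0 < xi < 1;
  eta_itv : 0 < eta <= 1 / 2;
  gamma_gt0 : 0 < gamma;
  eps_gt0 : 0 < eps
}.

Section Farsa.
Context {R : realType} {n : nat}.
Variables (f : 'cV[R]_n -> R) (lambda : R) (c : farsa_constants R).
Implicit Types (x y d : 'cV[R]_n) (I : {set 'I_n}) (j : nat).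

Local Notation F := (objective f lambda).
Local Notation beta := (beta f lambda).
Local Notation phi := (phi f lambda).
Local Notation optimality := (optimality f lambda).
Local Notation reduced_grad := (reduced_grad f lambda).
Local Notation reduced_hess := (reduced_hess f).

Definition reduced_model I x (d : 'cV[R]_#|I|) : R :=
  dot (reduced_grad I x) d + 1 / 2 * dot d (reduced_hess I x *m d).

(* the direction d^R = - alpha g with alpha = |g|^2 / (g^T H g) *)
Definition reference_direction I x : 'cV[R]_#|I| :=
  let g := reduced_grad I x in
  - (norm2 g ^+ 2 / dot g (reduced_hess I x *m g)) *: g.

(* I and d are permitted choices of I_k and d_k in the phi-branch at x = x_k *)
Definition phi_choice x I d : Prop :=
  [/\ forall i, i \in I -> phi x i 0 != 0,
      norm2 (subvec I (phi x)) >= eta_phi c * norm2 (phi x),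
      forall i, i \notin I -> d i 0 = 0
    & exists dbar : 'cV[R]_#|I|,
        [/\ dot (reduced_grad I x) dbar
              <= dot (reduced_grad I x) (reference_direction I x),
            reduced_model x dbar <= reduced_model x (0 : 'cV[R]_#|I|)
          & subvec I d = dbar]].

(* I and d are permitted choices of I_k and d_k in the beta-branch at x = x_k *)
Definition beta_choice x I d : Prop :=
  [/\ forall i, i \in I -> beta x i 0 != 0,
      norm2 (subvec I (beta x)) >= eta_beta c * norm2 (beta x),
      forall i, i \notin I -> d i 0 = 0
    & subvec I d = - subvec I (beta x)].

(* sup of an unbounded set is junk, but this is only evaluated once some trial
   point of the while-loop has changed sign, and then the set is bounded. *)
Definition alpha_B x d : R :=
  sup [set a : R | 0 < a /\ sgn (x + a *: d) = sgn x].

Definition trial x d j : 'cV[R]_n := proj (x + xi c ^+ j *: d) x.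

(* subvec I d is dbar_k when d = d_k and I = I_k. *)
Definition phi_armijo x I d (a : R) : bool :=
  F (x + a *: d) <= F x + eta c * a * dot (reduced_grad I x) (subvec I d).

Definition beta_armijo x d (a : R) : bool :=
  F (x + a *: d) <= F x - eta c * a * norm2 d ^+ 2.

(* Control points of the algorithm.  The line searches are executed one trial
   at a time, so that a non-terminating line search is an infinite execution. *)
Inductive state : Type :=
| Iterate of 'cV[R]_n (* x_k *)
| PhiWhile of 'cV[R]_n & {set 'I_n} & 'cV[R]_n & nat (* x_k, I_k, d_k, j *)
| PhiBacktrack of 'cV[R]_n & {set 'I_n} & 'cV[R]_n & nat (* x_k, I_k, d_k, j *)
| BetaBacktrack of 'cV[R]_n & 'cV[R]_n & nat (* x_k, d_k, j *)
| Return of 'cV[R]_n.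

Inductive step : state -> state -> Prop :=
| step_return x :
    optimality x <= eps c ->
    step (Iterate x) (Return x)
| step_phi_branch x I d :
    ~~ (optimality x <= eps c) ->
    norm2 (beta x) <= gamma c * norm2 (phi x) ->
    phi_choice x I d ->
    step (Iterate x) (PhiWhile x I d 0%N)
| step_beta_branch x I d :
    ~~ (optimality x <= eps c) ->
    ~~ (norm2 (beta x) <= gamma c * norm2 (phi x)) ->
    beta_choice x I d ->
    step (Iterate x) (BetaBacktrack x d 0%N)
| step_while_accept x I d j :
    sgn (trial x d j) <> sgn x ->
    F (trial x d j) <= F x ->
    step (PhiWhile x I d j) (Iterate (trial x d j))
| step_while_reject x I d j :
    sgn (trial x d j) <> sgn x ->
    ~~ (F (trial x d j) <= F x) ->
    step (PhiWhile x I d j) (PhiWhile x I d j.+1)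
| step_boundary_accept x I d j :
    sgn (trial x d j) = sgn x ->
    j <> 0%N ->
    phi_armijo x I d (alpha_B x d) ->
    step (PhiWhile x I d j) (Iterate (x + alpha_B x d *: d))
| step_while_exit x I d j :
    sgn (trial x d j) = sgn x ->
    j = 0%N \/ ~~ phi_armijo x I d (alpha_B x d) ->
    step (PhiWhile x I d j) (PhiBacktrack x I d j)
| step_phi_accept x I d j :
    phi_armijo x I d (xi c ^+ j) ->
    step (PhiBacktrack x I d j) (Iterate (x + xi c ^+ j *: d))
| step_phi_reject x I d j :
    ~~ phi_armijo x I d (xi c ^+ j) ->
    step (PhiBacktrack x I d j) (PhiBacktrack x I d j.+1)
| step_beta_accept x d j :
    beta_armijo x d (xi c ^+ j) ->
    step (BetaBacktrack x d j) (Iterate (x + xi c ^+ j *: d))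
| step_beta_reject x d j :
    ~~ beta_armijo x d (xi c ^+ j) ->
    step (BetaBacktrack x d j) (BetaBacktrack x d j.+1).

(* s_0, ..., s_T is an execution from x0; s is irrelevant beyond T. *)
Definition execution x0 (s : nat -> state) (T : nat) : Prop :=
  s 0%N = Iterate x0 /\ forall t, (t < T)%N -> step (s t) (s t.+1).

End Farsa.

(* Main.v *)
Require Import Defs.
From mathcomp Require Import all_boot all_order all_algebra.
From mathcomp Require Import all_classical all_reals all_analysis.
From mathcomp Require Import ring lra.

(** Every iteration of the algorithm starts at a point of the level set and does
    one of two things: it decreases the objective by a fixed amount [delta], or
    it does not increase the objective and removes a nonzero coordinate.  The
    objective is bounded below on the level set, so only finitely many iterations
    are of the first kind, and at most [n] consecutive ones are of the second.

    The amount [delta] comes from the Armijo condition.  While the tolerance is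
    not met, the measure on which the algorithm acts is bounded away from zero,
    and so is the slope along the direction.  For [beta] that slope is minus the
    squared length of the direction ([beta_choice_descent]).  For [phi] the
    comparison with the reference direction and the upper bound on the Hessian
    make the slope steep ([phi_choice_descent]), and the decrease of the model
    with the lower bound on the Hessian makes it at least proportional to the
    squared length of the direction ([phi_choice_length]).  Such a slope and the
    Lipschitz gradient imply that all steps shorter than a constant [tau] satisfy
    the Armijo condition, as long as the l1 norm is linear along the step
    ([armijo_short_step]).  A step found by backtracking is therefore at least
    [xi * tau], or it is the full step.

    In the [phi] branch the l1 norm is linear only up to the boundary of the
    orthant of the current point.  A step that is accepted on that boundary,
    after projection or at [alpha_B], loses a nonzero coordinate
    ([support_size_lt]); if instead the step to the boundary is rejected it was
    longer than [tau], and backtracking inside the orthant starts from a step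
    of comparable length ([phi_while_halts]).

    The line searches are part of the execution, so their termination is needed
    too: no step of length [tau] or less is rejected by the Armijo test, and
    signs are preserved by short steps.  All of this is organized as one induction that proves
    [halts_optimally], from which the finiteness of runs and the optimality of
    their last state both follow. *)

Set Implicit Arguments.
Unset Strict Implicit.
Unset Printing Implicit Defensive.

Import Order.TTheory GRing.Theory Num.Theory.
Import numFieldNormedType.Exports.
Local Open Scope ring_scope.

(** * Euclidean vectors and their restrictions to index sets *)

Section Vectors.
Context {R : realType} {n : nat}.
Implicit Types (u v x y d : 'cV[R]_n) (I : {set 'I_n}).

Lemma dotE m (u v : 'cV[R]_m) : dot u v = \sum_i u i 0 * v i 0.
Proof. by rewrite /dot mxE; apply: eq_bigr => i _; rewrite mxE. Qed.

Lemma dotZr m (u v : 'cV[R]_m) a : dot u (a *: v) = a * dot u v.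
Proof. by rewrite /dot -scalemxAr mxE. Qed.

Lemma dotZl m (u v : 'cV[R]_m) a : dot (a *: u) v = a * dot u v.
Proof. by rewrite /dot linearZ /= -scalemxAl mxE. Qed.

Lemma dotBl m (u v w : 'cV[R]_m) : dot (u - v) w = dot u w - dot v w.
Proof. by rewrite /dot linearB /= mulmxBl !mxE. Qed.

Lemma dotDl m (u v w : 'cV[R]_m) : dot (u + v) w = dot u w + dot v w.
Proof. by rewrite /dot linearD /= mulmxDl !mxE. Qed.

Lemma norm2_ge0 m (v : 'cV[R]_m) : 0 <= norm2 v.
Proof. exact: sqrtr_ge0. Qed.

Lemma norm2_sqr m (v : 'cV[R]_m) : norm2 v ^+ 2 = dot v v.
Proof.
by rewrite sqr_sqrtr ?sumr_ge0 ?dotE // => i _; rewrite sqr_ge0.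
Qed.

Lemma norm2N m (v : 'cV[R]_m) : norm2 (- v) = norm2 v.
Proof. by congr Num.sqrt; apply: eq_bigr => i _; rewrite mxE sqrrN. Qed.

Lemma norm2Z m a (v : 'cV[R]_m) : 0 <= a -> norm2 (a *: v) = a * norm2 v.
Proof.
move=> a0; apply: (@pexpIrn _ 2) => //; rewrite ?nnegrE ?mulr_ge0 ?norm2_ge0 //.
by rewrite exprMn !norm2_sqr dotZl dotZr mulrA.
Qed.

Lemma ler_norm2 m (u v : 'cV[R]_m) :
  (forall i, `|u i 0| <= `|v i 0|) -> norm2 u <= norm2 v.
Proof.
move=> uv; rewrite ler_sqrt ?sumr_ge0 // => [|i _]; last by rewrite sqr_ge0.
apply: ler_sum => i _; rewrite -[u i 0 ^+ 2]real_normK ?num_real //.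
by rewrite -[v i 0 ^+ 2]real_normK ?num_real // ler_sqr ?nnegrE.
Qed.

(** A bound by [c * norm2 v] on the length of [u] is all that is asked of [u],
    so Young's inequality, applied to each term, gives the conclusion of
    Cauchy-Schwarz. *)
Lemma dot_le_norm2 m (u v : 'cV[R]_m) c :
  0 < c -> norm2 u <= c * norm2 v -> dot u v <= c * norm2 v ^+ 2.
Proof.
move=> c0 uv.
have : norm2 u ^+ 2 <= c ^+ 2 * norm2 v ^+ 2.
  by rewrite -exprMn ler_sqr ?nnegrE ?mulr_ge0 ?norm2_ge0 // ltW.
have : 2 * c * dot u v <= norm2 u ^+ 2 + c ^+ 2 * norm2 v ^+ 2.
  rewrite !norm2_sqr !dotE !mulr_sumr -big_split /=.
  apply: ler_sum => i _; have := sqr_ge0 (u i 0 - c * v i 0); lra.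
set a := norm2 u ^+ 2; set b := norm2 v ^+ 2; set e := dot u v => h1 h2.
have : c * (2 * e) <= c * (2 * (c * b)) by lra.
rewrite ler_pM2l //; lra.
Qed.

Lemma subvecE I v j : subvec I v j 0 = v (enum_val j) 0.
Proof. by rewrite mxE. Qed.

(** A vector that vanishes outside [I] loses nothing when it is cut down to
    [I].  This moves every inner product of the reduced model, which lives in
    dimension [#|I|], back to the ambient space. *)
Lemma sum_subvec I v (G : 'I_n -> R) :
    (forall i, i \notin I -> v i 0 = 0) ->
  \sum_(j < #|I|) G (enum_val j) * subvec I v j 0 = \sum_i G i * v i 0.
Proof.
move=> v0; under eq_bigr do rewrite subvecE.
rewrite -(big_enum_val (fun i => G i * v i 0)) /= [RHS](bigID (mem I)) /=.
by rewrite [X in _ + X]big1 ?addr0 // => i /v0 ->; rewrite mulr0.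
Qed.

Lemma dot_subvec I u v : (forall i, i \notin I -> v i 0 = 0) ->
  dot (subvec I u) (subvec I v) = dot u v.
Proof.
move=> v0; rewrite !dotE -(sum_subvec (fun i => u i 0) v0).
by apply: eq_bigr => j _; rewrite subvecE.
Qed.

Lemma norm2_subvec I v : (forall i, i \notin I -> v i 0 = 0) ->
  norm2 (subvec I v) = norm2 v.
Proof.
move=> v0; apply: (@pexpIrn _ 2); rewrite ?nnegrE ?norm2_ge0 //.
by rewrite !norm2_sqr dot_subvec.
Qed.

Lemma submat_mul I (M : 'M[R]_n) v : (forall i, i \notin I -> v i 0 = 0) ->
  submat I M *m subvec I v = subvec I (M *m v).
Proof.
move=> v0; apply/colP => j; rewrite subvecE !mxE.
rewrite -(sum_subvec (fun i => M (enum_val j) i) v0).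
by apply: eq_bigr => k _; rewrite mxE.
Qed.

Lemma dot_submat I (M : 'M[R]_n) v : (forall i, i \notin I -> v i 0 = 0) ->
  dot (subvec I v) (submat I M *m subvec I v) = dot v (M *m v).
Proof.
move=> v0; rewrite submat_mul //.
have dotC m (a b : 'cV[R]_m) : dot a b = dot b a.
  by rewrite !dotE; apply: eq_bigr => i _; rewrite mulrC.
by rewrite dotC dot_subvec // dotC.
Qed.

Definition zero_outside I v : 'cV[R]_n := \col_i (if i \in I then v i 0 else 0).

Lemma zero_outside0 I v i : i \notin I -> zero_outside I v i 0 = 0.
Proof. by rewrite mxE => /negbTE ->. Qed.

Lemma subvec_zero_outside I v : subvec I (zero_outside I v) = subvec I v.
Proof. by apply/colP => j; rewrite !subvecE mxE enum_valP. Qed.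

End Vectors.

(** * Differentiation and convexity along lines *)

Section Smooth.
Context {R : realType} {n : nat}.
Variables (f : 'cV[R]_n -> R).
Implicit Types (x y d : 'cV[R]_n).

Lemma derive_dot_grad x d : differentiable f x -> 'D_d f x = dot (grad f x) d.
Proof.
move=> df; rewrite deriveE // dotE [X in 'd f x X]matrix_sum_delta linear_sum.
by apply: eq_bigr => i _; rewrite big_ord1 linearZ /= mxE deriveE // mulrC.
Qed.

(** The difference quotients of [u |-> f (x + u *: d)] at [t] are those of the
    directional derivative of [f] at [x + t *: d]. *)
Lemma is_derive_line x d t : differentiable f (x + t *: d) ->
  is_derive t 1 (fun u => f (x + u *: d)) (dot (grad f (x + t *: d)) d).
Proof.
move=> df; have dd := diff_derivable (v := d) df.
have E : (fun h : R => h^-1 *: ((fun u => f (x + u *: d)) \o shift t) (h *: 1)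
   - h^-1 *: f (x + t *: d)) =
   (fun h : R => h^-1 *: ((f \o shift (x + t *: d)) (h *: d) - f (x + t *: d))).
  apply/funext => h /=; rewrite scalerBr scaler1 scalerDl.
  by rewrite [x + _]addrCA.
split.
  by rewrite /derivable; under eq_fun do rewrite scalerBr; rewrite E.
rewrite -derive_dot_grad // /derive.
by under eq_fun do rewrite scalerBr; rewrite E.
Qed.

Lemma convex_functionP x y t : convex_function [set: 'cV[R]_n]%classic f ->
  0 <= t <= 1 -> f (t *: x + (1 - t) *: y) <= t * f x + (1 - t) * f y.
Proof.
move=> cf /andP[t0 t1].
have := cf (Itv01 t0 t1) x y; rewrite !inE => /(_ Logic.I Logic.I).
exact.
Qed.

End Smooth.

Lemma derive_lt0_decreases {R : realType} (k : R -> R) (c t : R) :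
    is_derive (0 : R) (1 : R) k c -> c < 0 -> 0 < t ->
  exists2 e, 0 < e < t & k e < k 0.
Proof.
move=> [dk <-] c0 t0.
have /cvg_dnbhs_at_right cv := dk.
near ((0 : R)^'+)%classic => h.
have hq : h^-1 *: ((k \o shift 0) (h *: 1) - k 0) < 0.
  by near: h; exact: (cvgr_lt _ cv).
have h0 : 0 < h by near: h; exact: nbhs_right_gt.
have ht : h < t by near: h; exact: nbhs_right_lt.
exists h; first by rewrite h0 ht.
move: hq; rewrite /= scaler1 addr0 pmulr_rlt0 ?invr_gt0 //.
by rewrite subr_lt0.
Unshelve. all: by end_near.
Qed.

(** * Short steps satisfy the Armijo condition *)

Section LineSearch.
Context {R : realType} {n : nat}.
Variables (f : 'cV[R]_n -> R) (lambda : R) (x0 : 'cV[R]_n) (L : R).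
Hypothesis lambda_ge0 : 0 <= lambda.
Hypothesis f_convex : convex_function [set: 'cV[R]_n]%classic f.
Hypothesis f_diff : forall x, differentiable f x.
Hypothesis L_gt0 : 0 < L.
Local Notation F := (objective f lambda).
Hypothesis f_lip : forall x y,
  level_set f lambda x0 x -> level_set f lambda x0 y ->
  norm2 (grad f x - grad f y) <= L * norm2 (x - y).
Implicit Types (x y d : 'cV[R]_n).

Lemma objective_convex x y t : 0 <= t <= 1 ->
  F (t *: x + (1 - t) *: y) <= t * F x + (1 - t) * F y.
Proof.
move=> t01; have /andP[t0 t1] := t01.
have N : norm1 (t *: x + (1 - t) *: y) <= t * norm1 x + (1 - t) * norm1 y.
  rewrite /norm1 !mulr_sumr -big_split /=; apply: ler_sum => i _; rewrite !mxE.
  apply: (le_trans (ler_normD _ _)).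
  by rewrite !normrM (ger0_norm t0) (@ger0_norm _ (1 - t)) // subr_ge0.
have C := convex_functionP x y f_convex t01.
have := ler_wpM2l lambda_ge0 N; rewrite /objective; lra.
Qed.

(** Convexity keeps a whole segment in the level set as soon as its far end
    point is there. *)
Lemma objective_segment x d b u : 0 <= u <= b -> F (x + b *: d) <= F x ->
  F (x + u *: d) <= F x.
Proof.
move=> /andP[u0 ub] Fb.
have [b0|b0] := eqVneq b 0.
  have -> : u = 0 by apply/eqP; rewrite eq_le u0 -b0 ub.
  by rewrite scale0r addr0.
have bp : 0 < b by rewrite lt_neqAle eq_sym b0 (le_trans u0).
have t01 : 0 <= u / b <= 1.
  by rewrite divr_ge0 ?(ltW bp) //= ler_pdivrMr // mul1r.
have := objective_convex (x + b *: d) x t01.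
have -> : (u / b) *: (x + b *: d) + (1 - u / b) *: x = x + u *: d.
  rewrite scalerDr scalerA divfK // scalerBl scale1r.
  by rewrite addrAC addrCA subrr addr0.
move/le_trans; apply.
have /andP[v0 v1] := t01.
have := ler_wpM2l v0 Fb; lra.
Qed.

(** The quadratic upper bound given by a Lipschitz gradient.  Lipschitz
    continuity is known on the level set only, so the segment has to stay
    there. *)
Lemma descent_lemma x d b : 0 <= b ->
    (forall u, 0 <= u <= b -> level_set f lambda x0 (x + u *: d)) ->
  f (x + b *: d) <=
    f x + b * dot (grad f x) d + L / 2 * b ^+ 2 * norm2 d ^+ 2.
Proof.
rewrite le_eqVlt => /orP[/eqP <- _|b0 lev].
  by rewrite scale0r addr0 mul0r expr0n /= mulr0 mul0r !addr0.
pose D := dot (grad f x) d.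
pose k u := f (x + u *: d) - u * D - L / 2 * u ^+ 2 * norm2 d ^+ 2.
pose dk u := dot (grad f (x + u *: d)) d - D - L * u * norm2 d ^+ 2.
have kd (u : R) : is_derive u (1 : R) k (dk u).
  have H := is_derive_line (f_diff (x + u *: d)).
  apply: is_derive_eq.
  rewrite /dk /D; move: (dot _ _) (dot _ _) (norm2 d) => p q r.
  rewrite /GRing.scale /=; lra.
have kc : {within `[0, b], continuous k}%classic.
  by apply: derivable_within_continuous => v _; case: (kd v).
have [c /andP[]] := @MVT R k dk 0 b b0 (fun v _ => kd v) kc.
rewrite !bnd_simp => c0 cb E.
have lx : level_set f lambda x0 x.
  by have := lev 0; rewrite scale0r addr0; apply; rewrite lexx ltW.
have lc : level_set f lambda x0 (x + c *: d) by apply: lev; rewrite !ltW.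
have : dk c <= 0.
  rewrite /dk /D -dotBl subr_le0; apply: dot_le_norm2; first exact: mulr_gt0.
  apply: le_trans (f_lip lc lx) _.
  by rewrite [x + _]addrC addrK norm2Z ?(ltW c0) // mulrA.
move=> dk0; have : dk c * (b - 0) <= 0 by rewrite subr0 mulr_le0_ge0 ?(ltW b0).
rewrite -E /k scale0r addr0 -/D; nra.
Qed.

(** Along [d] the l1 norm grows linearly with slope [s] up to step [a], so
    [dot (grad f x) d + lambda * s] is the slope of the objective.  The descent
    lemma would give the Armijo inequality at once for
    [t <= 2 * (1 - eta) * kappa / L] if the segment were known to lie in the
    level set.  It is not: the trial point may have left it.  Suppose that the
    inequality fails at [t].  For tiny steps it holds strictly, because
    [eta < 1], so by continuity there is a step [b < t] at which it is an equality.  That step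
    does not increase the objective, hence by convexity the segment up to [b]
    lies in the level set, and the descent lemma makes the inequality strict at
    [b], a contradiction. *)
Lemma armijo_short_step x d s a kappa eta t :
    level_set f lambda x0 x ->
    (forall u, 0 <= u <= a -> norm1 (x + u *: d) = norm1 x + u * s) ->
    dot (grad f x) d + lambda * s < 0 ->
    dot (grad f x) d + lambda * s <= - kappa * norm2 d ^+ 2 ->
    0 <= eta < 1 -> 0 <= t <= a -> t <= 2 * (1 - eta) * kappa / L ->
  F (x + t *: d) <= F x + eta * t * (dot (grad f x) d + lambda * s).
Proof.
set D := _ + _ => lx lin D0 Dk /andP[e0 e1] /andP[t0 ta] tL.
move: t0; rewrite le_eqVlt => /orP[/eqP<-|t0].
  by rewrite scale0r addr0 mulr0 mul0r addr0.
rewrite leNgt; apply/negP => bad.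
(* The excess over the Armijo bound, with the l1 norm replaced by its linear
   extension so that the function is differentiable everywhere. *)
pose k u := f (x + u *: d) - f x + u * (lambda * s - eta * D).
have kE u : 0 <= u <= a -> k u = F (x + u *: d) - F x - eta * u * D.
  by move=> ua; rewrite /k /objective lin //; ring.
have kd (u : R) : is_derive u (1 : R) k
    (dot (grad f (x + u *: d)) d + (lambda * s - eta * D)).
  have H := is_derive_line (f_diff (x + u *: d)).
  apply: is_derive_eq; rewrite /D; move: (dot _ _) (dot _ _) => p q.
  rewrite /GRing.scale /=; ring.
have k0 : k 0 = 0 by rewrite /k scale0r addr0 subrr mul0r addr0.
have := kd 0; rewrite scale0r addr0 => kd0.
have slope : dot (grad f x) d + (lambda * s - eta * D) = (1 - eta) * D.
  by rewrite /D; ring.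
have [|e /andP[ep et]] := derive_lt0_decreases kd0 _ t0.
  by rewrite slope pmulr_rlt0 // subr_gt0.
rewrite k0 => ke.
have kt : 0 < k t by rewrite kE ?(ltW t0) //; move: bad; lra.
have kc : {within `[e, t], continuous k}%classic.
  by apply: derivable_within_continuous => v _; case: (kd v).
have [|b /andP[]] := IVT (v := 0) (ltW et) kc.
  by rewrite ge_min le_max (ltW ke) (ltW kt) orbT.
rewrite !bnd_simp => eb bt kb0.
have b0 : 0 < b := lt_le_trans ep eb.
have {}bt : b < t.
  by rewrite lt_neqAle bt andbT; apply: contraTneq kt => <-; rewrite kb0 ltxx.
have ba : 0 <= b <= a by rewrite ltW //= (le_trans (ltW bt)).
have Fb : F (x + b *: d) = F x + eta * b * D.
  by have := kE b ba; rewrite kb0; lra.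
have FbF : F (x + b *: d) <= F x.
  by rewrite Fb gerDl mulr_ge0_le0 ?mulr_ge0 // ltW.
have lev u : 0 <= u <= b -> level_set f lambda x0 (x + u *: d).
  by move=> ub; apply: le_trans (objective_segment ub FbF) lx.
have := descent_lemma (ltW b0) lev.
move: Fb; rewrite /objective lin // => Fb.
set q := norm2 d ^+ 2 => dl.
have q0 : 0 <= q by rewrite sqr_ge0.
have : L * b < 2 * (1 - eta) * kappa.
  by apply: lt_le_trans (_ : L * t <= _);
     rewrite ?ltr_pM2l // -ler_pdivlMl // mulrC.
set Q := _ * kappa => Lb.
have : b * (L * b) * q <= b * Q * q.
  by rewrite ler_wpM2r // ler_wpM2l // ltW.
have : b * ((1 - eta) * D) <= b * ((1 - eta) * (- kappa * q)).
  by rewrite ler_pM2l // ler_wpM2l // subr_ge0 ltW.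
(* [L * b < 2 * (1 - eta) * kappa] is strict, but it is multiplied by [q]; for
   [q = 0] the strict inequality comes from the slope [D] instead. *)
have [q00|qn] := eqVneq q 0.
  move: Dk; rewrite -/q q00 mulr0; move: (mulr_gt0 b0 L_gt0) => *.
  have : b * ((1 - eta) * D) < 0 by rewrite pmulr_rlt0 // pmulr_rlt0 // subr_gt0.
  move: Fb dl; rewrite q00 /D; lra.
have qp : 0 < q by rewrite lt_neqAle eq_sym qn.
have : b * (L * b) * q < b * Q * q by rewrite ltr_pM2r // ltr_pM2l.
move: Fb dl; rewrite /Q /D; lra.
Qed.

End LineSearch.

(** * Orthants *)

Section Orthants.
Context {R : realType} {n : nat}.
Implicit Types (x y d : 'cV[R]_n).

Definition support_size x : nat := #|[set i | x i 0 != 0]|.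

Definition supported_by x y : Prop := forall i, x i 0 = 0 -> y i 0 = 0.

Definition same_closed_orthant x y : Prop := forall i, 0 <= x i 0 * y i 0.

Lemma sgnP x y : sgn y = sgn x <-> forall i, Num.sg (y i 0) = Num.sg (x i 0).
Proof.
split=> [E i|E]; first by have := congr1 (fun M => fun_of_matrix M i 0) E; rewrite !mxE.
by apply/colP => i; rewrite !mxE.
Qed.

Lemma eq_sgr (a b : R) :
  (Num.sg a = Num.sg b) <-> [/\ (0 < b -> 0 < a), (b < 0 -> a < 0) & (b = 0 -> a = 0)].
Proof.
split=> [E|[p m z]].
  split=> [b0|b0|b0].
  - by rewrite -sgr_gt0 E sgr_gt0.
  - by rewrite -sgr_lt0 E sgr_lt0.
  - by apply/eqP; rewrite -sgr_eq0 E sgr_eq0 b0.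
case: (ltrgt0P b) => [b0|b0|b0].
- by rewrite !gtr0_sg ?p.
- by rewrite !ltr0_sg ?m.
- by rewrite z // b0.
Qed.

(** Within the closed orthant of [x] a sign can only change by becoming
    zero. *)
Lemma support_size_lt x y :
  supported_by x y -> same_closed_orthant x y -> sgn y <> sgn x ->
  (support_size y < support_size x)%N.
Proof.
move=> xy o ne; apply: proper_card; apply/properP; split.
  by apply/fintype.subsetP => i; rewrite !inE; apply: contra_neq; exact: xy.
apply: contrapT => H; apply: ne; apply/sgnP => i.
have {}H : x i 0 != 0 -> y i 0 != 0.
  move=> xi; apply/negP => yi; apply: H; exists i; rewrite !inE //.
  by rewrite yi.
apply/eq_sgr; split=> [x0|x0|]; last exact: xy.
  rewrite lt_neqAle eq_sym H ?gt_eqF //=.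
  by have := o i; rewrite pmulr_rge0.
rewrite lt_neqAle H ?lt_eqF //=.
by have := o i; rewrite nmulr_rge0.
Qed.

(** The l1 norm is linear on a closed orthant, and a closed orthant that
    contains both ends of a segment contains the segment. *)
Lemma norm1_line x d a u :
  supported_by x d -> same_closed_orthant x (x + a *: d) -> 0 <= u <= a ->
  norm1 (x + u *: d) = norm1 x + u * dot (sgn x) d.
Proof.
move=> xd o /andP[u0 ua]; rewrite dotE mulr_sumr -big_split /=.
apply: eq_bigr => i _; rewrite !mxE; have := o i; rewrite !mxE.
move: (xd i) u0 ua; set p := x i 0; set q := d i 0; clearbody p q.
case: (ltrgt0P p) => [p0|p0|->] qz u0 ua.
- rewrite gtr0_sg // pmulr_rge0 // => h.
  rewrite (@ger0_norm _ (p + u * q)); first by ring.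
  by case: (lerP 0 q) => q0; nra.
- rewrite ltr0_sg // nmulr_rge0 // => h.
  rewrite (@ler0_norm _ (p + u * q)); first by ring.
  by case: (lerP 0 q) => q0; nra.
- by rewrite qz // sgr0 !mulr0 !add0r normr0 mulr0.
Qed.

(** Open orthants are convex. *)
Lemma sgn_line x d a u : sgn (x + a *: d) = sgn x -> 0 <= u <= a ->
  sgn (x + u *: d) = sgn x.
Proof.
move=> /sgnP E /andP[u0 ua]; apply/sgnP => i; have := E i; rewrite !mxE.
move: u0 ua; set p := x i 0; set q := d i 0; clearbody p q => u0 ua.
have [->|une] := eqVneq u 0; first by rewrite mul0r addr0.
have up : 0 < u by rewrite lt_neqAle eq_sym une.
move=> /eq_sgr[h1 h2 h3]; apply/eq_sgr; split=> [p0|p0|p0].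
- by have := h1 p0; case: (lerP 0 q) => q0; nra.
- by have := h2 p0; case: (lerP 0 q) => q0; nra.
- have /eqP := h3 p0; rewrite p0 add0r mulf_eq0 gt_eqF ?(lt_le_trans up) //=.
  by move=> /eqP ->; rewrite mulr0 addr0.
Qed.

(** Open orthants are open, relative to the coordinate subspace of [x]. *)
Lemma sgn_short_step x d : supported_by x d ->
  exists2 e, 0 < e & forall t, 0 <= t <= e -> sgn (x + t *: d) = sgn x.
Proof.
move=> xd.
have H i : exists e : R, 0 < e /\
    forall t, 0 <= t <= e -> Num.sg (x i 0 + t * d i 0) = Num.sg (x i 0).
  have [x0|x0] := eqVneq (x i 0) 0.
    by exists 1; split=> // t _; rewrite xd // mulr0 addr0.
  exists (`|x i 0| / (`|d i 0| + 1)).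
  have dp : 0 < `|d i 0| + 1 by rewrite ltr_wpDl.
  split=> [|t /andP[t0 te]]; first by rewrite divr_gt0 // normr_gt0.
  move: te; rewrite ler_pdivlMr // => te.
  have lt : `|t * d i 0| < `|x i 0|.
    rewrite normrM ger0_norm //.
    have [->|tn] := eqVneq t 0; first by rewrite mul0r normr_gt0.
    apply: lt_le_trans te; rewrite ltr_pM2l ?ltrDl //.
    by rewrite lt_neqAle eq_sym tn.
  move: lt; rewrite ltr_norml => /andP[l1 l2].
  apply/eq_sgr; split=> [p|p|/eqP].
  - by move: l1; rewrite gtr0_norm //; lra.
  - by move: l2; rewrite ltr0_norm //; lra.
  - by rewrite (negbTE x0).
have [e He] := fin_all_exists H.
exists (\big[Num.min/1]_i e i).
  by apply/bigmin_gtP; split=> // i _; case: (He i).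
move=> t /andP[t0 te]; apply/sgnP => i; rewrite !mxE.
case: (He i) => _; apply; rewrite t0 /=.
by apply: le_trans te _; apply: bigmin_le_cond.
Qed.

Lemma sgn_same_closed_orthant x y : sgn y = sgn x -> same_closed_orthant x y.
Proof.
move=> /sgnP E i; rewrite -sgr_ge0 sgrM E -expr2; exact: sqr_ge0.
Qed.

Lemma supported_line x d a : supported_by x d -> supported_by x (x + a *: d).
Proof. by move=> xd i xi; rewrite !mxE xi xd // mulr0 addr0. Qed.

(** The projected trial point leaves the open orthant exactly when the
    unprojected one does. *)
Lemma sgn_proj x y : supported_by x y ->
  (sgn (Defs.proj y x) = sgn x <-> sgn y = sgn x).
Proof.
move=> xy; split=> /sgnP E; apply/sgnP => i; have := E i; rewrite !mxE.
all: move: (xy i); set p := x i 0; set q := y i 0; clearbody p q.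
all: case: (ltrgt0P p) => [p0|p0|->] qz; rewrite ?(gtr0_sg p0) ?(ltr0_sg p0).
- by case: (lerP 0 q) => q0 //; rewrite sgr0 => /eqP; rewrite eq_sym oner_eq0.
- case: (lerP 0 q) => q0 //.
  by rewrite sgr0 => /eqP; rewrite eq_sym oppr_eq0 oner_eq0.
- by rewrite qz.
- by case: (lerP 0 q) => q0 //; rewrite ltr0_sg // => /eqP; rewrite eqr_oppLR; lra.
- by case: (lerP 0 q) => q0 //; move=> E'; move: q0; rewrite -sgr_ge0 E'; lra.
- by [].
Qed.

Lemma supported_proj x y : supported_by x (Defs.proj y x).
Proof. by move=> i xi; rewrite mxE xi ltxx. Qed.

Lemma proj_same_closed_orthant x y : same_closed_orthant x (Defs.proj y x).
Proof.
move=> i; rewrite mxE; case: (ltrgt0P (x i 0)) => [x0|x0|->].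
- by rewrite pmulr_rge0 // le_max lexx.
- by rewrite nmulr_rge0 // ge_min lexx.
- by rewrite mul0r.
Qed.

(** The step to the boundary of the orthant, bracketed by a step [a] that keeps
    all signs and a step [b] that does not.  The orthant is convex, so all steps
    that keep the signs are below [b]; it is relatively open, so the supremum of
    these steps is not one of them, while it still belongs to the closed
    orthant. *)
Section Boundary.
Variables (x d : 'cV[R]_n) (a b : R).
Hypotheses (xd : supported_by x d) (a_gt0 : 0 < a) (b_ge0 : 0 <= b).
Hypotheses (Ha : sgn (x + a *: d) = sgn x) (Hb : sgn (x + b *: d) <> sgn x).

Let A := [set a : R | 0 < a /\ sgn (x + a *: d) = sgn x]%classic.

Let A_ub : ubound A b.
Proof.
move=> t [t0 Ht]; rewrite leNgt; apply/negP => bt.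
by apply: Hb; apply: sgn_line Ht _; rewrite b_ge0 ltW.
Qed.

Lemma alpha_B_le : alpha_B x d <= b.
Proof. by apply: ge_sup => //; exists a. Qed.

Lemma le_alpha_B : a <= alpha_B x d.
Proof. by apply: ub_le_sup; [exists b | split]. Qed.

Lemma alpha_B_gt0 : 0 < alpha_B x d.
Proof. exact: lt_le_trans le_alpha_B. Qed.

Lemma alpha_B_closed_orthant : same_closed_orthant x (x + alpha_B x d *: d).
Proof.
move=> i; rewrite !mxE leNgt; apply/negP => neg.
have x2 := sqr_ge0 (x i 0).
have pq : x i 0 * d i 0 < 0.
  rewrite -(pmulr_rlt0 _ alpha_B_gt0); move: neg; lra.
(* If coordinate [i] had changed sign at the supremum, the step at which it
   vanishes would be a smaller upper bound. *)
suff : alpha_B x d <= - (x i 0 ^+ 2 / (x i 0 * d i 0)).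
  by rewrite -mulrN -invrN ler_pdivlMr ?oppr_gt0 //; move: neg; lra.
apply: ge_sup; first by exists a.
move=> t [t0 /sgn_same_closed_orthant /(_ i)]; rewrite !mxE => ht.
by rewrite -mulrN -invrN ler_pdivlMr ?oppr_gt0 //; move: ht; lra.
Qed.

Lemma sgn_alpha_B : sgn (x + alpha_B x d *: d) <> sgn x.
Proof.
move=> E.
have [|e e0 /(_ e)] := @sgn_short_step (x + alpha_B x d *: d) d.
  move=> i Ei; apply: xd; have /sgnP/(_ i) := E; rewrite Ei sgr0.
  by move/esym/eqP; rewrite sgr_eq0 => /eqP.
rewrite lexx ltW // => /(_ isT); rewrite E -addrA -scalerDl => E'.
have : alpha_B x d + e <= alpha_B x d.
  apply: ub_le_sup; first by exists b.
  by split=> //; rewrite addr_gt0 // alpha_B_gt0.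
by rewrite gerDl leNgt e0.
Qed.

End Boundary.

End Orthants.

(** * Search directions *)

Section Directions.
Context {R : realType} {n : nat}.
Variables (f : 'cV[R]_n -> R) (lambda : R) (c : farsa_constants R).
Implicit Types (x y d : 'cV[R]_n) (I : {set 'I_n}).

Local Notation beta := (Defs.beta f lambda).
Local Notation phi := (Defs.phi f lambda).
Local Notation g := (reduced_grad f lambda).
Local Notation H := (reduced_hess f).

Lemma phi_support x i : phi x i 0 != 0 -> x i 0 != 0.
Proof. by apply: contra_neq => xi; rewrite mxE xi eqxx. Qed.

(** [phi] is the gradient of the objective truncated towards zero, hence the
    reduced gradient is large when [phi] is. *)
Lemma phi_le_grad x i : `|phi x i 0| <= `|(grad f x + lambda *: sgn x) i 0|.
Proof.
rewrite !mxE; set u := x i 0; set v := 'D__ _ _; clearbody u v.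
case: (ltrgt0P u) => [u0|u0|->] /=; last by rewrite normr0.
- rewrite gtr0_sg // mulr1; case: ltP => //= vp.
  rewrite (gtr0_norm vp) ger0_norm ?ge_min ?lexx // le_min (ltW vp) /=.
  by rewrite le_max (ltW u0).
- rewrite ltr0_sg // mulrN1; case: ltP => //= vp.
  rewrite (ltr0_norm vp) ler0_norm ?lerN2 ?le_max ?lexx // ge_max (ltW vp) /=.
  by rewrite ge_min (ltW u0).
Qed.

Lemma reduced_grad_dot I x d : (forall i, i \notin I -> d i 0 = 0) ->
  dot (g I x) (subvec I d) = dot (grad f x) d + lambda * dot (sgn x) d.
Proof. by move=> d0; rewrite dot_subvec // dotDl dotZl. Qed.

Lemma reduced_grad_zero_outside I x :
  g I x = subvec I (zero_outside I (grad f x + lambda *: sgn x)).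
Proof. by rewrite subvec_zero_outside. Qed.

Lemma reduced_model0 I x : reduced_model f lambda x (0 : 'cV[R]_#|I|) = 0.
Proof. by rewrite /reduced_model mulmx0 /dot !mulmx0 mxE mulr0 addr0. Qed.

Section PhiDirection.
Variables (x : 'cV[R]_n) (theta_min theta_max : R).
Hypotheses (tmin0 : 0 < theta_min) (tmax0 : 0 < theta_max).
Hypothesis hessB : forall v, theta_min * norm2 v ^+ 2 <= dot v (hess f x *m v)
  <= theta_max * norm2 v ^+ 2.

Lemma reduced_curvature I :
  theta_min * norm2 (g I x) ^+ 2 <= dot (g I x) (H I x *m g I x)
    <= theta_max * norm2 (g I x) ^+ 2.
Proof.
rewrite reduced_grad_zero_outside dot_submat ?norm2_subvec ?hessB //.
all: exact: zero_outside0.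
Qed.

Lemma dot_reference_direction I :
  dot (g I x) (reference_direction f lambda I x)
    = - (norm2 (g I x) ^+ 4 / dot (g I x) (H I x *m g I x)).
Proof.
rewrite /reference_direction dotZr -norm2_sqr.
set q := dot _ _; move: (norm2 _) (q^-1) => a b; ring.
Qed.

Lemma phi_choice_supported I d : phi_choice f lambda c x I d -> supported_by x d.
Proof.
move=> [Iphi _ dI _] i xi; apply: dI; apply/negP => /Iphi /phi_support.
by rewrite xi eqxx.
Qed.

Lemma phi_choice_grad I d : phi_choice f lambda c x I d ->
  eta_phi c * norm2 (phi x) <= norm2 (g I x).
Proof.
move=> [_ h _ _]; apply: le_trans h _; apply: ler_norm2 => j.
by rewrite !subvecE; exact: phi_le_grad.
Qed.

(** The reference direction minimizes the quadratic model along the steepest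
    descent line, where its slope is [- |g|^4 / (g^T H g)]; the upper curvature
    bound controls the denominator. *)
Lemma phi_choice_descent I d : phi_choice f lambda c x I d ->
  theta_max * dot (g I x) (subvec I d) <= - norm2 (g I x) ^+ 2.
Proof.
move=> [_ _ _ [dbar [h _ ->]]].
rewrite (le_trans (ler_wpM2l (ltW tmax0) h)) // dot_reference_direction.
rewrite mulrN lerN2.
have /andP[q1 q2] := reduced_curvature I; move: q1 q2.
set q := dot _ _; set a := norm2 _ => q1 q2.
have a0 : 0 <= a ^+ 2 by exact: sqr_ge0.
have a4 : a ^+ 4 = a ^+ 2 * a ^+ 2 by rewrite -exprD.
have [a00|an] := eqVneq (a ^+ 2) 0.
  by rewrite a4 a00 !mul0r mulr0.
have ap : 0 < a ^+ 2 by rewrite lt_neqAle eq_sym an.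
have q0 : 0 < q by apply: lt_le_trans q1; exact: mulr_gt0.
rewrite mulrA ler_pdivlMr // a4.
by rewrite mulrCA ler_pM2l.
Qed.

(** A model value below that of the zero step means that the slope outweighs
    the quadratic term, which the lower curvature bound compares with the squared
    length.  So a long direction is also a steep one. *)
Lemma phi_choice_length I d : phi_choice f lambda c x I d ->
  dot (g I x) (subvec I d) <= - (theta_min / 2) * norm2 d ^+ 2.
Proof.
move=> [_ _ d0 [dbar [_ h E]]]; move: h.
rewrite reduced_model0 /reduced_model -E dot_submat // => h.
have /andP[h1 _] := hessB d; lra.
Qed.

(** The reference direction itself, for the largest admissible index set, is a
    permitted choice: its model value is [- (1/2) |g|^4 / (g^T H g)]. *)
Lemma phi_choice_exists : exists I d, phi_choice f lambda c x I d.
Proof.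
pose I := [set i | phi x i 0 != 0].
pose a := norm2 (g I x) ^+ 2 / dot (g I x) (H I x *m g I x).
exists I, (- a *: zero_outside I (grad f x + lambda *: sgn x)); split.
- by move=> i; rewrite inE.
- have phi0 i : i \notin I -> phi x i 0 = 0 by rewrite inE negbK => /eqP.
  rewrite norm2_subvec // ler_piMl ?norm2_ge0 //.
  by case/andP: (eta_phi_itv c).
- by move=> i iI; rewrite mxE zero_outside0 // mulr0.
exists (reference_direction f lambda I x); split=> //; last first.
  by rewrite /reference_direction -/a reduced_grad_zero_outside;
     apply/colP => j; rewrite !mxE.
have /andP[q1 q2] := reduced_curvature I.
rewrite reduced_model0 /reduced_model /reference_direction -/a.
rewrite -scalemxAr !dotZr dotZl -norm2_sqr.
(* For [g = 0] the quotient [a] is 0 by convention, and both sides vanish. *)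
have aq : a * (dot (g I x) (H I x *m g I x)) = norm2 (g I x) ^+ 2.
  have [g0|gn] := eqVneq (norm2 (g I x) ^+ 2) 0.
    by rewrite /a g0 !mul0r.
  rewrite /a divfK // gt_eqF // (lt_le_trans _ q1) // mulr_gt0 //.
  by rewrite lt_neqAle eq_sym gn sqr_ge0.
have a0 : 0 <= a.
  rewrite divr_ge0 ?sqr_ge0 // (le_trans _ q1) // mulr_ge0 ?sqr_ge0 //.
  exact: ltW.
have : 0 <= a * norm2 (g I x) ^+ 2 by rewrite mulr_ge0 ?sqr_ge0.
rewrite -aq; lra.
Qed.

End PhiDirection.

Lemma beta_choice_exists y : exists I d, beta_choice f lambda c y I d.
Proof.
pose I := [set i | beta y i 0 != 0].
have b0 i : i \notin I -> beta y i 0 = 0 by rewrite inE negbK => /eqP.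
exists I, (- beta y); split.
- by move=> i; rewrite inE.
- rewrite norm2_subvec // ler_piMl ?norm2_ge0 //.
  by case/andP: (eta_beta_itv c).
- by move=> i iI; rewrite mxE b0 ?oppr0.
- by apply/colP => j; rewrite !mxE.
Qed.

Section BetaDirection.
Variables (x : 'cV[R]_n) (I : {set 'I_n}) (d : 'cV[R]_n).
Hypothesis Id : beta_choice f lambda c x I d.

Lemma beta_choiceE i : (d i 0 = - beta x i 0) /\ beta x i 0 != 0 \/ d i 0 = 0.
Proof.
case: Id => Ib _ d0 E; case: (boolP (i \in I)) => iI; last by right; exact: d0.
left; split; last exact: Ib.
have /= := congr1 (fun M : 'cV[R]_#|I| => M (enum_rank_in iI i) 0) E.
by rewrite subvecE [in RHS]mxE subvecE enum_rankK_in.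
Qed.

Lemma beta_choice_norm2 : eta_beta c * norm2 (beta x) <= norm2 d.
Proof.
case: Id => _ h d0 E; apply: le_trans h _.
by rewrite -[norm2 d](norm2_subvec d0) E norm2N.
Qed.

(** The moving coordinates start at zero. *)
Lemma beta_choice_norm1 u : 0 <= u -> norm1 (x + u *: d) = norm1 x + u * norm1 d.
Proof.
move=> u0; rewrite /norm1 mulr_sumr -big_split; apply: eq_bigr => i _ /=.
rewrite !mxE; case: (beta_choiceE i) => [[_ bi]|->].
  have -> : x i 0 = 0.
    by apply/eqP; apply: contraNT bi => xi; rewrite mxE (negbTE xi).
  by rewrite normr0 !add0r normrM ger0_norm.
by rewrite normr0 !mulr0 !addr0.
Qed.

(** When coordinate [i] leaves zero with the sign of [- beta x i 0], the absolute
    value has the slope that [beta] already contains, so the objective changes at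
    the rate [beta x i 0]; moving by [- beta x i 0] contributes minus its
    square. *)
Lemma beta_choice_descent :
  dot (grad f x) d + lambda * norm1 d = - norm2 d ^+ 2.
Proof.
rewrite norm2_sqr !dotE /norm1 mulr_sumr -big_split -sumrN.
apply: eq_bigr => i _ /=.
case: (beta_choiceE i) => [[-> +]|->]; last by rewrite normr0 !mulr0 addr0 oppr0.
rewrite mxE; set v := grad f x i 0; rewrite /=.
case: ifP => [/andP[_ b0]|_] _.
  rewrite (@gtr0_norm _ (- _)) ?oppr_gt0 //; ring.
case: ifP => [/andP[_ b0]|_]; last first.
  by rewrite !(oppr0, normr0, mulr0, addr0).
rewrite (@ltr0_norm _ (- _)) ?oppr_lt0 //; ring.
Qed.

End BetaDirection.

End Directions.

(** * Halting as a well-founded property *)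

(** Induction along a backtracking search, from longer to shorter steps, when
    the steps that are ever reached are bounded below by [s]. *)
Lemma backtracking_ind {R : realType} (r s : R) (P : nat -> Prop) :
    0 < r < 1 -> 0 < s ->
    (forall j, s <= r ^+ j -> (s <= r ^+ j.+1 -> P j.+1) -> P j) ->
  forall j, s <= r ^+ j -> P j.
Proof.
move=> /andP[r0 r1] s0 IH.
have [J rJ] : exists J, r ^+ J < s.
  have [|J _ /(_ J (leqnn J)) /=] := @cvgr_lt _ _ _ _ _ _ (@cvg_expr R r _) s s0.
    by rewrite gtr0_norm.
  by exists J.
move=> j; have [m] : exists m, (J <= j + m)%N by exists J; exact: leq_addl.
elim: m j => [|m IHm] j Jjm sj; apply: IH => // sj'.
  move: Jjm; rewrite addn0 => Jj; move: sj; rewrite leNgt.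
  by rewrite (le_lt_trans _ rJ) // ler_wiXn2l // ltW.
by apply: IHm sj'; rewrite addSnnS.
Qed.

Section Halting.
Context {R : realType} {n : nat}.
Variables (f : 'cV[R]_n -> R) (lambda : R) (c : farsa_constants R).

(** Accessibility for the inverse of [step], together with the absence of bad
    dead ends.  Since [step] is a relation, the second clause ranges over all
    choices of index sets and directions; one induction then serves for both
    the finiteness of runs and the optimality of what they return. *)
Inductive halts_optimally (s : @state R n) : Prop :=
| Halts of (exists2 x, s = Return x & optimality f lambda x <= eps c)
           \/ (exists s', step f lambda c s s')
         & (forall s', step f lambda c s s' -> halts_optimally s').

Lemma halts_no_infinite_run s0 : halts_optimally s0 ->
  forall s : nat -> state, s 0%N = s0 ->
  ~ (forall t, step f lambda c (s t) (s t.+1)).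
Proof.
elim=> {}s0 _ _ IH s s00 run; apply: (IH (s 1%N) _ (fun t => s t.+1)) => //.
by rewrite -s00.
Qed.

Lemma halts_run s (T : nat) : halts_optimally (s 0%N) ->
  (forall t, (t < T)%N -> step f lambda c (s t) (s t.+1)) ->
  halts_optimally (s T).
Proof.
elim: T => [h _|T IH h run]; first exact: h.
have [|_ succ] := IH h; first by move=> t tT; apply: run; exact: ltnW.
exact/succ/run.
Qed.

End Halting.

(** * Decrease of the objective and the lexicographic induction *)

Section Convergence.
Context {R : realType} {n : nat}.
Variables (f : 'cV[R]_n -> R) (lambda : R) (c : farsa_constants R).
Variables (x0 : 'cV[R]_n) (fmin L theta_min theta_max : R).
Implicit Types (x y d : 'cV[R]_n) (I : {set 'I_n}).

Local Notation F := (objective f lambda).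
Local Notation beta := (Defs.beta f lambda).
Local Notation phi := (Defs.phi f lambda).
Local Notation g := (reduced_grad f lambda).
Local Notation level := (level_set f lambda x0).
Local Notation halts := (halts_optimally f lambda c).

Hypothesis lambda_gt0 : 0 < lambda.
Hypothesis f_convex : convex_function [set: 'cV[R]_n]%classic f.
Hypothesis f_diff : forall x, differentiable f x.
Hypothesis f_bounded : forall x, level x -> fmin <= f x.
Hypothesis L_gt0 : 0 < L.
Hypothesis f_lip : forall x y, level x -> level y ->
  norm2 (grad f x - grad f y) <= L * norm2 (x - y).
Hypotheses (tmin0 : 0 < theta_min) (tmax0 : 0 < theta_max).
Hypothesis hessB : forall x v, level x ->
  theta_min * norm2 v ^+ 2 <= dot v (hess f x *m v)
    <= theta_max * norm2 v ^+ 2.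

(** In both branches the slope along the direction [d] is at most
    [- kappa * norm2 d ^+ 2]: the factor is 1 for [beta] and half the lower
    curvature bound for [phi]. *)
Let kappa : R := Num.min 1 (theta_min / 2).
(** Steps of this length or less satisfy the Armijo condition
    ([armijo_short_step]). *)
Let tau : R := 2 * (1 - eta c) * kappa / L.
(** Backtracking does not go below this length: a step is shortened only after
    it failed the Armijo condition, and then it was longer than [tau]. *)
Let sigma : R := Num.min 1 (xi c * tau).
(** At a point which is not optimal to within the tolerance, the measure that
    the algorithm selects has at least this norm. *)
Let rho : R := Num.min (eps c) (Num.min (eps c / gamma c) (gamma c * eps c)).
(** The decrease of the objective guaranteed by an Armijo step. *)
Let delta : R := eta c * sigma *
  Num.min ((eta_phi c * rho) ^+ 2 / theta_max) ((eta_beta c * rho) ^+ 2).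

Let eta_gt0 : 0 < eta c. Proof. by case/andP: (eta_itv c). Qed.
Let eta_lt1 : eta c < 1. Proof. by case/andP: (eta_itv c); lra. Qed.
Let xi_gt0 : 0 < xi c. Proof. by case/andP: (xi_itv c). Qed.
Let xiX_gt0 j : 0 < xi c ^+ j. Proof. exact: exprn_gt0. Qed.
Let kappa_gt0 : 0 < kappa.
Proof. by rewrite lt_min ltr01 divr_gt0. Qed.
Let tau_gt0 : 0 < tau.
Proof. by rewrite divr_gt0 // !mulr_gt0 // subr_gt0. Qed.
Let sigma_gt0 : 0 < sigma.
Proof. by rewrite lt_min ltr01 mulr_gt0. Qed.
Let rho_gt0 : 0 < rho.
Proof.
by rewrite !lt_min eps_gt0 divr_gt0 ?mulr_gt0 ?eps_gt0 ?gamma_gt0.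
Qed.
Let eta_phi_gt0 : 0 < eta_phi c. Proof. by case/andP: (eta_phi_itv c). Qed.
Let eta_beta_gt0 : 0 < eta_beta c. Proof. by case/andP: (eta_beta_itv c). Qed.
Let delta_gt0 : 0 < delta.
Proof.
rewrite mulr_gt0 ?mulr_gt0 // lt_min divr_gt0 //=.
  by rewrite exprn_gt0 // mulr_gt0.
by rewrite exprn_gt0 // mulr_gt0.
Qed.

Lemma sigma_le1 : sigma <= xi c ^+ 0.
Proof. by rewrite expr0 ge_min lexx. Qed.

Lemma sigma_le_next j : tau < xi c ^+ j -> sigma <= xi c ^+ j.+1.
Proof.
by move=> h; rewrite ge_min exprS ler_pM2l // (ltW h) orbT.
Qed.

Lemma delta_le j a : sigma <= xi c ^+ j ->
  Num.min ((eta_phi c * rho) ^+ 2 / theta_max) ((eta_beta c * rho) ^+ 2) <= a ->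
  delta <= eta c * xi c ^+ j * a.
Proof.
move=> sj ma; have m0 : 0 <= Num.min ((eta_phi c * rho) ^+ 2 / theta_max)
    ((eta_beta c * rho) ^+ 2).
  by rewrite le_min divr_ge0 ?(ltW tmax0) ?sqr_ge0.
by rewrite ler_pM ?(ler_pM2l eta_gt0) // mulr_ge0 ?(ltW eta_gt0) ?(ltW sigma_gt0).
Qed.

(** What one iteration achieves.  Steps that stop at, or are projected onto, the
    boundary of an orthant may gain arbitrarily little, but they remove nonzero
    coordinates. *)
Definition progress x y : Prop :=
  F y <= F x - delta \/ F y <= F x /\ (support_size y < support_size x)%N.

Lemma beta_branch_norm x :
    ~~ (optimality f lambda x <= eps c) ->
    ~~ (norm2 (beta x) <= gamma c * norm2 (phi x)) ->
  rho <= norm2 (beta x).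
Proof.
rewrite -!ltNge lt_max => /orP[h1 _|h1 h2]; first by rewrite ge_min (ltW h1).
rewrite !ge_min; apply/orP; right; apply/orP; right.
by apply: le_trans (ltW h2); rewrite ler_pM2l ?gamma_gt0 // ltW.
Qed.

Lemma phi_branch_norm x :
    ~~ (optimality f lambda x <= eps c) ->
    norm2 (beta x) <= gamma c * norm2 (phi x) ->
  rho <= norm2 (phi x).
Proof.
rewrite -ltNge lt_max => /orP[h1 h2|h1 _]; last by rewrite ge_min (ltW h1).
rewrite !ge_min; apply/orP; right; apply/orP; left.
by rewrite ler_pdivrMr ?gamma_gt0 // mulrC (le_trans (ltW h1)).
Qed.

Section BetaSearch.
Variables (x : 'cV[R]_n) (I : {set 'I_n}) (d : 'cV[R]_n).
Hypotheses (xL : level x) (Id : beta_choice f lambda c x I d).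
Hypothesis x_rho : rho <= norm2 (beta x).

Lemma beta_direction_norm : (eta_beta c * rho) ^+ 2 <= norm2 d ^+ 2.
Proof.
rewrite ler_sqr ?nnegrE ?norm2_ge0 ?mulr_ge0 ?(ltW rho_gt0) ?(ltW eta_beta_gt0) //.
by apply: le_trans (beta_choice_norm2 Id); rewrite ler_pM2l.
Qed.

Lemma beta_armijo_short t : 0 <= t <= tau -> beta_armijo f lambda c x d t.
Proof.
move=> /andP[t0 tt]; rewrite /beta_armijo.
have q0 : 0 < norm2 d ^+ 2.
  by apply: lt_le_trans beta_direction_norm; rewrite exprn_gt0 // mulr_gt0.
have E := beta_choice_descent Id.
have := @armijo_short_step _ _ f lambda x0 L (ltW lambda_gt0) f_convex f_diff
  L_gt0 f_lip x d (norm1 d) t kappa (eta c) t xL.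
rewrite E mulrN; apply=> //.
- by move=> u /andP[u0 _]; exact: beta_choice_norm1 Id u u0.
- by rewrite oppr_lt0.
- by rewrite mulNr lerN2 ler_piMl ?(ltW q0) // ge_min lexx.
- by rewrite ltW.
- by rewrite t0 lexx.
Qed.

Lemma beta_search_halts j : sigma <= xi c ^+ j ->
  (forall y, progress x y -> halts (Iterate y)) ->
  halts (BetaBacktrack x d j).
Proof.
move=> sj next; move: j sj; apply: (backtracking_ind (xi_itv c) sigma_gt0).
move=> j sj IH; split.
  right; case: (boolP (beta_armijo f lambda c x d (xi c ^+ j))) => h.
    by exists (Iterate (x + xi c ^+ j *: d)); exact: step_beta_accept.
  by exists (BetaBacktrack x d j.+1); exact: step_beta_reject.
move=> s' st; inversion st as [| | | | | | | | |x' d' j' h|x' d' j' h]; subst.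
  apply: next; left; apply: le_trans h _; rewrite lerD2l lerN2.
  by apply: delta_le sj _; rewrite ge_min beta_direction_norm orbT.
apply: IH; apply: sigma_le_next; rewrite ltNge; apply: contra h => h.
by apply: beta_armijo_short; rewrite h ltW.
Qed.

End BetaSearch.

Section PhiSearch.
Variables (x : 'cV[R]_n) (I : {set 'I_n}) (d : 'cV[R]_n).
Hypotheses (xL : level x) (Id : phi_choice f lambda c x I d).
Hypothesis x_rho : rho <= norm2 (phi x).

Let S := dot (g I x) (subvec I d).

Let supp : supported_by x d := phi_choice_supported Id.

Lemma phi_slope_le : S <= - ((eta_phi c * rho) ^+ 2 / theta_max).
Proof.
have h := phi_choice_descent tmin0 tmax0 (fun v => hessB v xL) Id.
rewrite -mulNr ler_pdivlMr // mulrC; apply: le_trans h _.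
rewrite lerN2 ler_sqr ?nnegrE ?norm2_ge0 ?mulr_ge0 ?(ltW rho_gt0) ?(ltW eta_phi_gt0) //.
by apply: le_trans (phi_choice_grad Id); rewrite ler_pM2l.
Qed.

Lemma phi_slope_lt0 : S < 0.
Proof.
apply: le_lt_trans phi_slope_le _.
by rewrite oppr_lt0 divr_gt0 // exprn_gt0 // mulr_gt0.
Qed.

Lemma phi_armijo_short a t : same_closed_orthant x (x + a *: d) ->
  0 <= t <= a -> t <= tau -> phi_armijo f lambda c x I d t.
Proof.
move=> o ta tt; rewrite /phi_armijo.
have d0 : forall i, i \notin I -> d i 0 = 0 by case: Id.
have E := reduced_grad_dot f lambda x d0.
rewrite E.
apply: (@armijo_short_step _ _ f lambda x0 L (ltW lambda_gt0) f_convex f_diff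
  L_gt0 f_lip x d (dot (sgn x) d) a kappa (eta c) t xL) => //.
- by move=> u ua; exact: norm1_line supp o ua.
- by rewrite -E; exact: phi_slope_lt0.
- rewrite -E; apply: le_trans (phi_choice_length (fun v => hessB v xL) Id) _.
  by rewrite ler_wpM2r ?sqr_ge0 // lerN2 ge_min lexx orbT.
- by rewrite ltW.
Qed.

Lemma phi_armijo_decrease a y : 0 <= a ->
  F y <= F x + eta c * a * S -> F y <= F x.
Proof.
move=> a0 h; apply: le_trans h _; rewrite gerDl mulr_ge0_le0 //.
  by rewrite mulr_ge0 // ltW.
exact: ltW phi_slope_lt0.
Qed.

Lemma phi_backtrack_halts j :
  sgn (x + xi c ^+ j *: d) = sgn x -> sigma <= xi c ^+ j ->
  (forall y, progress x y -> halts (Iterate y)) ->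
  halts (PhiBacktrack x I d j).
Proof.
move=> Ej sj next; move: j sj Ej.
apply: (backtracking_ind (xi_itv c) sigma_gt0) => j sj IH Ej; split.
  right; case: (boolP (phi_armijo f lambda c x I d (xi c ^+ j))) => h.
    by exists (Iterate (x + xi c ^+ j *: d)); exact: step_phi_accept.
  by exists (PhiBacktrack x I d j.+1); exact: step_phi_reject.
move=> s' st.
inversion st as [| | | | | | |x' I' d' j' h|x' I' d' j' h| |]; subst.
  apply: next; left; apply: le_trans h _; rewrite lerD2l -/S.
  rewrite -lerN2 opprK -mulrN; apply: delta_le sj _.
  by rewrite ge_min lerNr phi_slope_le.
apply: IH; last first.
  apply: sgn_line Ej _; rewrite ltW //= exprS ler_piMl ?(ltW (xiX_gt0 _)) //.
  by case/andP: (xi_itv c) => _ /ltW.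
apply: sigma_le_next; rewrite ltNge; apply: contra h => h.
apply: (phi_armijo_short (sgn_same_closed_orthant Ej)) => //.
by rewrite lexx ltW.
Qed.

(** A trial point that has changed a sign lies on the boundary of the orthant of
    [x], and so does the point at step [alpha_B]; accepting either of them
    removes a nonzero coordinate.  If [alpha_B] fails the Armijo condition after
    a rejection, it is longer than [tau]; the preceding step was longer still,
    so the step with which backtracking starts is at least [xi * tau]. *)
Lemma phi_while_halts :
  (forall y, progress x y -> halts (Iterate y)) ->
  halts (PhiWhile x I d 0).
Proof.
move=> next.
have [e e0 He] := sgn_short_step supp.
have sgnT j : sgn (trial c x d j) = sgn x <-> sgn (x + xi c ^+ j *: d) = sgn x.
  by apply: sgn_proj; exact: supported_line.
(* Only steps longer than [e] can be rejected, and one factor [xi] is lost by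
   the rejection; the cap at 1 admits the initial step. *)
pose e' := xi c * Num.min 1 e.
have e'0 : 0 < e' by rewrite mulr_gt0 // lt_min ltr01.
suff : forall j, e' <= xi c ^+ j ->
    j = 0%N \/ sgn (x + xi c ^+ j.-1 *: d) <> sgn x ->
    halts (PhiWhile x I d j).
  apply; last by left.
  rewrite expr0 mulr_ile1 ?ge_min ?lexx ?(ltW xi_gt0) //.
    by rewrite ltW // lt_min ltr01.
  by case/andP: (xi_itv c) => _ /ltW.
apply: (backtracking_ind (xi_itv c) e'0) => j ej IH prev.
split.
  right; case: (pselect (sgn (trial c x d j) = sgn x)) => E; last first.
    case: (boolP (F (trial c x d j) <= F x)) => h.
      by eexists; exact: step_while_accept.
    by eexists; exact: step_while_reject.
  case: (eqVneq j 0%N) => j0.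
    by eexists; apply: step_while_exit => //; left.
  case: (boolP (phi_armijo f lambda c x I d (alpha_B x d))) => h.
    by eexists; apply: step_boundary_accept => //; exact/eqP.
  by eexists; apply: step_while_exit => //; right.
move=> s' st.
inversion st as [| | |x' I' d' j' h h'|x' I' d' j' h h'|x' I' d' j' h j0 h'
  |x' I' d' j' h h'| | | |]; subst.
- apply: next; right; split=> //; apply: support_size_lt h => //.
    exact: supported_proj.
  exact: proj_same_closed_orthant.
- have h1 : sgn (x + xi c ^+ j *: d) <> sgn x by move=> E; apply: h; apply/sgnT.
  apply: IH; last by right.
  rewrite exprS ler_pM2l // ge_min; apply/orP; right.
  rewrite leNgt; apply/negP => lt; apply: h1; apply: He.
  by rewrite !ltW.
- have Ej := (sgnT j).1 h.
  have B : sgn (x + xi c ^+ j.-1 *: d) <> sgn x by case: prev.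
  have p := alpha_B_gt0 (xiX_gt0 j) (ltW (xiX_gt0 j.-1)) Ej B.
  apply: next; right; split.
    by apply: phi_armijo_decrease h'; exact: ltW.
  apply: support_size_lt.
  + exact: supported_line.
  + exact: alpha_B_closed_orthant (xiX_gt0 j) (ltW (xiX_gt0 j.-1)) Ej B.
  + exact: sgn_alpha_B (xiX_gt0 j) (ltW (xiX_gt0 j.-1)) Ej B.
- have Ej := (sgnT j).1 h.
  apply: phi_backtrack_halts => //.
  case: h' => [->|h']; first exact: sigma_le1.
  case: j Ej prev {ej IH st h} => [|j] Ej; first by move=> _; exact: sigma_le1.
  case=> // B; apply: sigma_le_next.
  have a0 := ltW (xiX_gt0 j).
  apply: lt_le_trans (alpha_B_le (xiX_gt0 j.+1) a0 Ej B).
  rewrite ltNge; apply: contra h' => h'.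
  apply: (@phi_armijo_short (alpha_B x d)) => //.
    exact: alpha_B_closed_orthant (xiX_gt0 j.+1) a0 Ej B.
  by rewrite lexx ltW // (alpha_B_gt0 (xiX_gt0 j.+1) a0 Ej B).
Qed.

End PhiSearch.

Lemma iterate_halts_of_progress x : level x ->
  (forall y, progress x y -> halts (Iterate y)) -> halts (Iterate x).
Proof.
move=> xL next; split.
  right; case: (boolP (optimality f lambda x <= eps c)) => opt.
    by exists (Return x); exact: step_return.
  case: (boolP (norm2 (beta x) <= gamma c * norm2 (phi x))) => br.
    have [I [d Id]] := phi_choice_exists lambda c tmin0 (fun v => hessB v xL).
    by exists (PhiWhile x I d 0); exact: step_phi_branch.
  have [I [d Id]] := beta_choice_exists f lambda c x.
  by exists (BetaBacktrack x d 0); exact: step_beta_branch Id.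
move=> s' st.
inversion st as [x' h|x' I d h br Id|x' I d h br Id| | | | | | | |]; subst.
- split; first by left; exists x.
  by move=> s'' st'; inversion st'.
- by apply: phi_while_halts => //; exact: phi_branch_norm.
- by apply: (beta_search_halts xL Id) => //; [exact: beta_branch_norm | exact: sigma_le1].
Qed.

(** Lexicographic induction: first on the number of decreases by [delta] that
    fit between the objective at [x] and its lower bound, then on the number of
    nonzero coordinates. *)
Theorem iterate_halts x : level x -> halts (Iterate x).
Proof.
have [N] : exists N : nat, F x < fmin + N%:R * delta.
  exists (Num.bound `|(F x - fmin) / delta|).
  rewrite -ltrBlDl -ltr_pdivrMr //.
  by apply: le_lt_trans (ler_norm _) _; exact: archi_boundP.
elim: N x => [|N IHN] x.
  rewrite mul0r addr0 => lt xL; have := f_bounded xL.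
  have : f x <= F x by rewrite lerDl mulr_ge0 ?(ltW lambda_gt0) // sumr_ge0.
  move=> h1 h2; move: (lt_le_trans lt (le_trans h2 h1)).
  by rewrite ltxx.
have [m] := ubnP (support_size x).
elim: m x => [x|m IHm x xm xN xL]; first by rewrite ltn0 => /notF.
apply: (iterate_halts_of_progress xL) => y [yx|[yx ys]].
  apply: IHN; last first.
    by apply: le_trans xL; apply: le_trans yx _; rewrite gerBl ltW.
  apply: le_lt_trans yx _; rewrite ltrBlDr.
  by apply: lt_le_trans xN _; rewrite -natr1 mulrDl mul1r addrA.
apply: IHm; first exact: leq_trans ys _.
  exact: le_lt_trans yx xN.
exact: le_trans yx xL.
Qed.

End Convergence.

(** * Finite termination *)

(* No execution is infinite, and an execution that cannot be continued has
   returned an eps-optimal point. *)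
Theorem theorem3p10 (R : realType) (n : nat) (f : 'cV[R]_n -> R) (lambda : R)
    (c : farsa_constants R) (x0 : 'cV[R]_n)
    (lambda_gt0 : 0 < lambda)
    (f_assumption : standing_assumption f lambda x0) :
  (forall s : nat -> state,
     ~ (forall T : nat, execution f lambda c x0 s T))
  /\
  (forall (s : nat -> state) (T : nat),
     execution f lambda c x0 s T ->
     (forall s' : state, ~ step f lambda c (s T) s') ->
     exists2 x : 'cV[R]_n, s T = Return x & optimality f lambda x <= eps c).
Proof.
case: f_assumption => f_convex [f_diff _ _] [fmin f_bd] [L L0 f_lip]
  [tmin [tmax [tmin0 tmax0 hessB]]].
have h0 : halts_optimally f lambda c (Iterate x0).
  apply: (iterate_halts c lambda_gt0 f_convex f_diff f_bd L0 f_lip tmin0 tmax0) => //.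
  exact: lexx.
split=> [s run|s T [s0 run] stuck].
  apply: (halts_no_infinite_run h0 (s := s)); first by case: (run 0%N).
  by move=> t; have [_] := run t.+1; apply.
have [|[//|[s' /stuck]] //] := halts_run (s := s) _ run.
by rewrite s0.
Qed.
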